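(* Consider the linear map $$H:\mathbf{WQSym}\to\mathbb{K}[X],\qquad w\mapsto H_{\max(w)}(X)\quad(w\text{ a packed word}).$$ It is a surjective Hopf algebra morphism, and the diagram formed by the maps $EHR,EHR^{str},\Theta,\theta,\lfloor\cdot\rfloor,ehr,ehr^{str},H$ commutes, that is: $$EHR^{str}\circ\Theta=EHR,\quad ehr^{str}\circ\theta=ehr,\quad \theta\circ\lfloor\cdot\rfloor=\lfloor\cdot\rfloor\circ\Theta,\quad ehr\circ\lfloor\cdot\rfloor=H\circ EHR,\quad ehr^{str}\circ\lfloor\cdot\rfloor=H\circ EHR^{str}.$$
   Context: $\mathbb{K}$ is a field of characteristic zero, $[n]=\{1,\ldots,n\}$, $H_k(X)=\frac{X(X-1)\cdots(X-k+1)}{k!}$. $\mathbb{K}[X]$ is a Hopf algebra with its usual product and $\Delta(X)=X\otimes1+1\otimes X$. A quasi-poset is a pair $P=(A,\leq_P)$ with $A$ finite and $\leq_P$ reflexive and transitive; $i\sim_Pj$ means $i\leq_Pj$ and $j\leq_Pi$. Its topology has for open sets the subsets $O$ with ($i\in O$, $i\leq_Pj$)$\Rightarrow j\in O$; $P$ is connected if this topology is. $\mathbf{QP}$ is the set of quasi-posets on the sets $[n]$, $n\ge0$; $\mathbf{qp}$ the set of isoclasses; $\mathcal{H}_{\mathbf{QP}},\mathcal{H}_{\mathbf{qp}}$ are the $\mathbb{K}$-vector spaces with these bases; $\lfloor\cdot\rfloor:\mathcal{H}_{\mathbf{QP}}\to\mathcal{H}_{\mathbf{qp}}$ sends $P$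 to its isoclass. For an equivalence $\sim$ on $A$, $P/\sim$ is the quasi-poset on $A$ whose quasi-order is the transitive closure of ($x\leq_Py$ or $x\sim y$); $\sim\triangleleft P$ means that the restriction of $P$ to each class of $\sim$ is connected and $\sim_{P/\sim}$ equals $\sim$. $\Theta:\mathcal{H}_{\mathbf{QP}}\to\mathcal{H}_{\mathbf{QP}}$, $\Theta(P)=\sum_{\sim\triangleleft P}P/\sim$, and $\theta:\mathcal{H}_{\mathbf{qp}}\to\mathcal{H}_{\mathbf{qp}}$, $\theta(\lfloor P\rfloor)=\sum_{\sim\triangleleft P}\lfloor P/\sim\rfloor$. A packed word of length $n$ is a word $w=w_1\ldots w_n$ in positive integers with $\{w_1,\ldots,w_n\}=[k]$ for some $k\geq0$, identified with the map $i\mapsto w(i)=w_i$. For any word $w$ in positive integers, $Pack(w)$ is obtained by applying to the letters the unique increasing bijection from the set of letters onto some $[k]$; $w_I$ is the subword formed by the letters in $I$. $\mathbf{WQSym}$ is the Hopf algebra with basis the packed words, product $u.v=\sum w$ (for $u,v$ of lengths $k,l$) over packed words $w=x_1\ldots x_{k+l}$ with $Pack(x_1\ldots x_k)=u$ and $Pack(x_{k+1}\ldots x_{k+l})=v$, unit the empty word, and coproduct $\Delta(w)=\sum_{k=0}^{\max(w)}w_{\{1,\ldots,k\}}\otimes Pack(w_{\{k+1,\ldots,\max(w)\}})$. For $P\in\mathbf{QP}$ on $[n]$, $W_P$ is the set of packed words $w$ of length $n$ with $i\leq_Pj\Rightarrow w(i)\leq w(j)$; $W^{str}_P$ is the set of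 $w\in W_P$ such that ($i\leq_Pj$ and $w(i)=w(j)$)$\Rightarrow i\sim_Pj$. $EHR(P)=\sum_{w\in W_P}w$ and $EHR^{str}(P)=\sum_{w\in W_P^{str}}w$ define linear maps $\mathcal{H}_{\mathbf{QP}}\to\mathbf{WQSym}$. For $k\ge1$, $L_P(k)$ is the set of maps $f:A\to[k]$ with $i\leq_Pj\Rightarrow f(i)\leq f(j)$, and $L^{str}_P(k)$ the set of $f\in L_P(k)$ such that ($i\leq_Pj$ and $f(i)=f(j)$)$\Rightarrow i\sim_Pj$; $ehr_P$, $ehr_P^{str}$ are the unique polynomials with $ehr_P(k)=\sharp L_P(k)$, $ehr_P^{str}(k)=\sharp L_P^{str}(k)$ for all $k\geq1$; $ehr,ehr^{str}:\mathcal{H}_{\mathbf{qp}}\to\mathbb{K}[X]$ are the corresponding linear maps. *)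

(* Defs.v *)
From HB Require Import structures.
From mathcomp Require Import all_boot all_order all_algebra.
From mathcomp Require Import finmap.
From mathcomp.multinomials Require Import monalg.

Set Implicit Arguments.
Unset Strict Implicit.
Unset Printing Implicit Defensive.

Import GRing.Theory.
Local Open Scope ring_scope.
Local Open Scope quotient_scope.

(* The vector space with basis [B] is [{malg K[B]}]; the basis vector indexed by
[b] is [<< b >>] and the coordinate of [a] along it is [a@_b]. *)

Section LinearExtension.
Variables (K : fieldType) (B : choiceType) (V : lmodType K).

Definition linext (f : B -> V) (a : {malg K[B]}) : V :=
  \sum_(b <- msupp a) a@_b *: f b.

Lemma linextEw (f : B -> V) (a : {malg K[B]}) (d : {fset B}) :
  (msupp a `<=` d)%fset -> linext f a = \sum_(b <- d) a@_b *: f b.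
Proof.
move=> sub; rewrite /linext (big_fset_incl _ sub) // => b _.
by rewrite -mcoeff_eq0 => /eqP ->; rewrite scale0r.
Qed.

Lemma linext_linear (f : B -> V) : linear (linext f).
Proof.
move=> c a b; pose d := (msupp a `|` msupp b)%fset.
rewrite (@linextEw f a d) ?fsubsetUl // (@linextEw f b d) ?fsubsetUr //.
rewrite (@linextEw f (c *: a + b) d).
  rewrite scaler_sumr -big_split /=; apply: eq_bigr => x _.
  by rewrite mcoeffD mcoeffZ scalerDl scalerA.
apply: fsubset_trans (msuppD_le _ _) _; apply: fsetSU; exact: msuppZ_le.
Qed.

HB.instance Definition _ (f : B -> V) :=
  GRing.isLinear.Build K {malg K[B]} V *:%R (linext f) (linext_linear f).

Lemma linextU (f : B -> V) (b : B) : linext f << b >> = f b.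
Proof.
rewrite (@linextEw f << b >> [fset b]%fset) ?msuppU_le //.
by rewrite big_seq_fset1 mcoeffUU scale1r.
Qed.

End LinearExtension.

Definition maxl (w : seq nat) : nat := \max_(a <- w) a.

(* The set of letters of [w] is [{1, ..., k}], necessarily with k = max(w). *)
Definition packed (w : seq nat) : bool :=
  all (mem (iota 1 (maxl w))) w && all (mem w) (iota 1 (maxl w)).

Lemma maxl_ub (w : seq nat) a : a \in w -> (a <= maxl w)%N.
Proof. by move=> aw; rewrite /maxl (big_rem a aw) /= leq_maxl. Qed.

Lemma maxl_iota (w : seq nat) k : w =i iota 1 k -> maxl w = k.
Proof.
move=> wE; apply/eqP; rewrite eqn_leq; apply/andP; split.
  apply/bigmax_leqP_seq => a; rewrite wE mem_iota add1n ltnS => /andP[_ ak] _.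
  exact: ak.
case: k wE => // k wE.
by apply: maxl_ub; rewrite wE mem_iota /= add1n ltnS.
Qed.

Lemma packedP (w : seq nat) : reflect (exists k, w =i iota 1 k) (packed w).
Proof.
apply: (iffP andP) => [[/allP w1 /allP w2] | [k wE]].
  by exists (maxl w) => a; apply/idP/idP => [/w1|/w2].
by rewrite (maxl_iota wE); split; apply/allP => a; rewrite /= wE.
Qed.

(* The rank of [a] among the distinct letters of [w]: on the letters of [w],
   this is the increasing bijection onto [{1, ..., k}]. *)
Definition rank_in (w : seq nat) (a : nat) : nat :=
  size (undup [seq b <- w | (b <= a)%N]).

Definition pack_seq (w : seq nat) : seq nat := map (rank_in w) w.

Lemma rank_in_le (w : seq nat) a b : (a <= b)%N -> (rank_in w a <= rank_in w b)%N.
Proof.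
move=> ab; apply: uniq_leq_size; first exact: undup_uniq.
move=> c; rewrite !mem_undup !mem_filter => /andP[ca ->].
by rewrite (leq_trans ca ab).
Qed.

Lemma rank_in_lt (w : seq nat) a b :
  b \in w -> (a < b)%N -> (rank_in w a < rank_in w b)%N.
Proof.
move=> bw ab; rewrite -[(rank_in w a).+1]/(size (b :: undup [seq c <- w | (c <= a)%N])).
apply: uniq_leq_size.
  by rewrite cons_uniq undup_uniq mem_undup mem_filter leqNgt ab.
move=> c; rewrite inE !mem_undup !mem_filter => /orP[/eqP -> | /andP[ca ->]].
  by rewrite leqnn.
by rewrite (leq_trans ca (ltnW ab)).
Qed.

Lemma rank_in_mono (w : seq nat) :
  {in w &, {mono rank_in w : a b / (a <= b)%N}}.
Proof.
move=> a b aw bw; apply/idP/idP; last exact: rank_in_le.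
by apply: contraTT; rewrite -!ltnNge; apply: rank_in_lt.
Qed.

Lemma pack_seq_packed (w : seq nat) : packed (pack_seq w).
Proof.
apply/packedP; exists (size (undup w)).
pose s := undup w; pose t := map (rank_in w) s.
have tE : pack_seq w =i t.
  by move=> a; apply/mapP/mapP => -[b bw ->]; exists b => //;
    move: bw; rewrite mem_undup.
have inj : {in s &, injective (rank_in w)}.
  move=> a b; rewrite !mem_undup => aw bw e; apply/eqP.
  by rewrite eqn_leq -(rank_in_mono aw bw) -(rank_in_mono bw aw) e leqnn.
have ut : uniq t by rewrite map_inj_in_uniq ?undup_uniq.
have sub : {subset t <= iota 1 (size s)}.
  move=> _ /mapP[b bs ->]; rewrite mem_iota add1n ltnS; apply/andP; split.
    rewrite /rank_in lt0n size_eq0; apply/eqP => e.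
    have : b \in undup [seq c <- w | (c <= b)%N].
      by rewrite mem_undup mem_filter leqnn -mem_undup.
    by rewrite e.
  apply: uniq_leq_size; first exact: undup_uniq.
  by move=> c; rewrite !mem_undup mem_filter => /andP[].
have [|_ sE] := uniq_min_size ut sub; first by rewrite size_iota size_map.
by move=> a; rewrite tE sE.
Qed.

Record pword := PWord { pw_val :> seq nat; pw_valP : packed pw_val }.
HB.instance Definition _ := [isSub for pw_val].
HB.instance Definition _ := [Countable of pword by <:].

Definition Pack (w : seq nat) : pword := PWord (pack_seq_packed w).

Fact packed_nil : packed [::]. Proof. by apply/packedP; exists 0%N. Qed.

Lemma Pack_id (w : pword) : Pack w = w.
Proof.
apply: val_inj; rewrite /= /pack_seq -[RHS]map_id; apply/eq_in_map => a aw /=.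
have /packedP[k wE] := pw_valP w.
have ak : (a <= k)%N by move: aw; rewrite wE mem_iota add1n ltnS => /andP[].
rewrite /rank_in -[RHS](size_iota 1); apply/perm_size/uniq_perm.
- exact: undup_uniq.
- exact: iota_uniq.
- move=> b; rewrite mem_undup mem_filter wE !mem_iota !add1n !ltnS.
  by case: (leqP b a) => ba; rewrite ?andbF // (leq_trans ba ak).
Qed.

Definition pw_nil : pword := PWord packed_nil.

Fact packed_low (w : pword) (k : nat) : packed [seq a <- w | (a <= k)%N].
Proof.
have /packedP[m wE] := pw_valP w.
apply/packedP; exists (minn k m) => a.
rewrite mem_filter wE !mem_iota !add1n !ltnS leq_min.
by case: (a <= k)%N => //=; rewrite andbF.
Qed.

(* The subword formed by the letters in [{1, ..., k}], which is packed. *)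
Definition pw_low (w : pword) (k : nat) : pword := PWord (packed_low w k).

Definition pw_high (w : pword) (k : nat) : pword :=
  Pack [seq a <- (w : seq nat) | (k < a)%N].

(* A packed word of length [n] has its letters at most [n]. *)
Definition pwords (n : nat) : seq pword :=
  pmap insub [seq map val (val t) | t <- enum {: n.-tuple 'I_n.+1}].

Lemma maxl_le_size (w : pword) : (maxl w <= size w)%N.
Proof.
have /packedP[k wE] := pw_valP w; rewrite (maxl_iota wE) -{1}(size_iota 1 k).
by apply: uniq_leq_size; [exact: iota_uniq | move=> a; rewrite wE].
Qed.

Lemma mem_pwords n (w : pword) : (w \in pwords n) = (size w == n).
Proof.
rewrite mem_pmap_sub; apply/mapP/eqP => [[t _ /= ->] | sz].
  by rewrite size_map size_tuple.
have sz' : size (map (@inord n) w) == n by rewrite size_map sz.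
exists (Tuple sz'); first by rewrite mem_enum.
rewrite /= -map_comp -[LHS]map_id; apply/eq_in_map => a aw /=.
rewrite inordK // ltnS -sz; apply: leq_trans (maxl_le_size w).
exact: maxl_ub.
Qed.

Lemma pwords_uniq n : uniq (pwords n).
Proof.
apply: pmap_sub_uniq; rewrite map_inj_uniq ?enum_uniq // => s t e.
apply/val_inj/(inj_map val_inj)/e.
Qed.

Section WQSym.
Variable K : fieldType.

Definition WQSym := {malg K[pword]}.

(* WQSym ⊗ WQSym, the basis vector [<< (u, v) >>] standing for u ⊗ v. *)
Definition WQSym2 := {malg K[(pword * pword)%type]}.

Definition wq_one : WQSym := << pw_nil >>.

Definition wq_mulb (u v : pword) : WQSym :=
  \sum_(w <- pwords (size u + size v)%N |
        (Pack (take (size u) w) == u) && (Pack (drop (size u) w) == v)) << w >>.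

Definition wq_mul (a b : WQSym) : WQSym :=
  linext (fun u => linext (wq_mulb u) b) a.

Definition wq_comulb (w : pword) : WQSym2 :=
  \sum_(0 <= k < (maxl w).+1) << (pw_low w k, pw_high w k) >>.

Definition wq_comul : WQSym -> WQSym2 := linext wq_comulb.

Definition wq_counit (a : WQSym) : K := a@_pw_nil.

End WQSym.

(* K[X] ⊗ K[X] is identified with K[X, Y], here [{poly {poly K}}] with outer
   variable X and inner variable Y, by p ⊗ q = p(X) q(Y). *)

Section PolyHopf.
Variable K : fieldType.

Definition ptens (p q : {poly K}) : {poly {poly K}} := map_poly polyC p * q%:P.

(* The algebra morphism sending X to X ⊗ 1 + 1 ⊗ X. *)
Definition poly_comul (p : {poly K}) : {poly {poly K}} :=
  (map_poly (fun c : K => c%:P%:P) p).[ptens 'X 1 + ptens 1 'X].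

Definition poly_counit (p : {poly K}) : K := p.[0].

End PolyHopf.

Section Hilbert.
Variable K : fieldType.

Definition hilb (k : nat) : {poly K} :=
  (k`!%:R)^-1 *: \prod_(i < k) ('X - (i%:R)%:P).

Definition Hmap : WQSym K -> {poly K} := linext (fun w : pword => hilb (maxl w)).

(* f ⊗ f for a linear map f : WQSym -> K[X], with values in K[X] ⊗ K[X]. *)
Definition tens_map (f : WQSym K -> {poly K}) (t : WQSym2 K) : {poly {poly K}} :=
  \sum_(b <- msupp t) (t@_b)%:P *: ptens (f << b.1 >>) (f << b.2 >>).

(* Compatibility with the antipodes is automatic for a bialgebra morphism
   between Hopf algebras. *)
Definition hopf_morphism (f : WQSym K -> {poly K}) : Prop :=
  [/\ linear f,
      f (wq_one K) = 1 /\ (forall a b, f (wq_mul a b) = f a * f b),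
      forall a, tens_map f (wq_comul a) = poly_comul (f a)
    & forall a, poly_counit (f a) = wq_counit a].

Lemma hilb_eval (charK : [pchar K] =i pred0) k n :
  (hilb k).[n%:R] = ('C(n, k))%:R.
Proof.
have fk : k`!%:R != 0 :> K by rewrite (pcharf0P K).1 // -lt0n fact_gt0.
rewrite /hilb hornerZ horner_prod; apply: (mulfI fk).
rewrite mulVKf // -natrM mulnC bin_ffact ffact_prod natr_prod.
case: (leqP k n) => kn.
  apply: eq_bigr => i _; rewrite !hornerE natrB //.
  by rewrite ltnW // (leq_trans (ltn_ord i)).
rewrite (bigD1 (Ordinal kn)) //= !hornerE subrr mul0r.
by rewrite (bigD1 (Ordinal kn)) //= subnn mul0r.
Qed.

End Hilbert.

Section QuasiPoset.
Variable A : finType.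

Definition quasi_order (r : {set A * A}) : bool :=
  [forall x, (x, x) \in r] &&
  [forall x, forall y, forall z,
     ((x, y) \in r) ==> ((y, z) \in r) ==> ((x, z) \in r)].

Record qposet := QPoset { qgraph : {set A * A}; qgraphP : quasi_order qgraph }.
HB.instance Definition _ := [isSub for qgraph].
HB.instance Definition _ := [Finite of qposet by <:].

Definition qle (P : qposet) : rel A := fun x y => (x, y) \in qgraph P.

Definition qsim (P : qposet) : rel A := fun x y => qle P x y && qle P y x.

Lemma qle_refl P : reflexive (qle P).
Proof. by move=> x; case/andP: (qgraphP P) => /forallP/(_ x). Qed.

Lemma qle_trans P : transitive (qle P).
Proof.
move=> y x z xy yz; case/andP: (qgraphP P) => _ /forallP/(_ x).
by move=> /forallP/(_ y)/forallP/(_ z)/implyP/(_ xy)/implyP/(_ yz).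
Qed.

Fact quasi_order_rel (r : rel A) : reflexive r -> transitive r ->
  quasi_order [set xy | r xy.1 xy.2].
Proof.
move=> rr rt; apply/andP; split; first by apply/forallP => x; rewrite inE.
apply/forallP => x; apply/forallP => y; apply/forallP => z; rewrite !inE /=.
by apply/implyP => xy; apply/implyP; apply: rt.
Qed.

Definition qposet_of (r : rel A) (rr : reflexive r) (rt : transitive r) : qposet :=
  QPoset (quasi_order_rel rr rt).

Definition equivalence_graph (s : {set A * A}) : bool :=
  quasi_order s && [forall x, forall y, ((x, y) \in s) ==> ((y, x) \in s)].

(* [connect] is the reflexive transitive closure; since [qle P] is reflexive it
   is here the transitive closure. *)
Definition qquot (P : qposet) (s : {set A * A}) : qposet :=
  let r := [rel x y | qle P x y || ((x, y) \in s)] in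
  qposet_of (@connect0 _ r) (@connect_trans _ r).

Definition qhomo (P : qposet) (f : A -> nat) : bool :=
  [forall x, forall y, qle P x y ==> (f x <= f y)%N].

Definition qhomo_str (P : qposet) (f : A -> nat) : bool :=
  qhomo P f && [forall x, forall y, (qle P x y && (f x == f y)) ==> qsim P x y].

(* Maps to [{1, ..., k}]; [i : 'I_k] stands for [i + 1]. *)
Definition qmaps (P : qposet) (k : nat) : {set {ffun A -> 'I_k}} :=
  [set f : {ffun A -> 'I_k} | qhomo P (fun x => f x)].

Definition qmaps_str (P : qposet) (k : nat) : {set {ffun A -> 'I_k}} :=
  [set f : {ffun A -> 'I_k} | qhomo_str P (fun x => f x)].

End QuasiPoset.

Section Topology.
Variable A : finType.

Definition qopen (P : qposet A) (O : {set A}) : bool :=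
  [forall x in O, forall y, qle P x y ==> (y \in O)].

Definition qconnected (P : qposet A) : bool :=
  [forall O : {set A}, qopen P O && qopen P (~: O) ==> (O == set0) || (O == setT)].

End Topology.

Definition qrestr (A : finType) (P : qposet A) (B : {set A}) :
    qposet {x : A | x \in B} :=
  @qposet_of {x : A | x \in B} (relpre val (qle P))
    (fun x => qle_refl P (val x)) (fun y x z => @qle_trans A P (val y) (val x) (val z)).

(* [s] is an equivalence on [A] with s ◁ P. *)
Definition qtriangle (A : finType) (s : {set A * A}) (P : qposet A) : bool :=
  [&& equivalence_graph s,
      [forall x, qconnected (qrestr P [set y | (x, y) \in s])]
    & [forall x, forall y, qsim (qquot P s) x y == ((x, y) \in s)]].

Section OrdinalImage.
Variables (A : finType) (C : (A -> nat) -> bool).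
Hypothesis C_compar : forall f g : A -> nat,
  (forall x y, (f x <= f y)%N = (g x <= g y)%N) -> C f = C g.

Let maps k := [set f : {ffun A -> 'I_k} | C (fun x => f x)].
Let onto m := [set f in maps m | f @: [set: A] == setT].

Fact enum_val_mono k (B : {set 'I_k}) (i j : 'I_#|B|) :
  ((enum_val i : 'I_k) <= (enum_val j : 'I_k))%N = (i <= j)%N.
Proof.
have st : sorted ltn (map val (enum B)).
  have : sorted ltn (map val (enum 'I_k)) by rewrite val_enum_ord iota_ltn_sorted.
  rewrite !sorted_map; rewrite ?enumT [enum_mem (mem B)]/enum_mem => h.
  by apply: sorted_filter h => y x z; apply: ltn_trans.
have szB : size (map val (enum B)) = #|B| by rewrite size_map -cardE.
have vE (l : 'I_#|B|) : (enum_val l : 'I_k) = nth 0%N (map val (enum B)) l :> nat.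
  by rewrite (nth_map (enum_default l)) // -cardE.
rewrite !vE; have lt_mono := sorted_ltn_nth ltn_trans 0%N st.
have := lt_mono i j; have := lt_mono j i.
rewrite !inE szB !ltn_ord => /(_ isT isT) ji /(_ isT isT) ij.
case: (ltngtP i j) => [/ij|/ji|/val_inj ->]; last by rewrite leqnn.
  by move=> /ltnW ->.
  by move=> h; apply/negbTE; rewrite -ltnNge.
Qed.

Fact card_fiber k (B : {set 'I_k}) :
  #|[set f in maps k | f @: [set: A] == B]| = #|onto #|B| |.
Proof.
pose F (f : {ffun A -> 'I_#|B|}) : {ffun A -> 'I_k} := [ffun x => enum_val (f x)].
have Finj : injective F.
  by move=> f g /ffunP e; apply/ffunP => x; move: (e x); rewrite !ffunE => /enum_val_inj.
have CF f : C (fun x => F f x) = C (fun x => f x).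
  by apply: C_compar => x y; rewrite !ffunE enum_val_mono.
rewrite -(card_imset _ Finj); congr #|pred_of_set _|; apply/setP => g.
apply/idP/imsetP.
  rewrite !inE => /andP[Cg /eqP gB].
  have gin x : g x \in B by rewrite -gB imset_f.
  pose f : {ffun A -> 'I_#|B|} := [ffun x => enum_rank_in (gin x) (g x)].
  have gE : g = F f by apply/ffunP => x; rewrite !ffunE enum_rankK_in.
  exists f => //; rewrite !inE -CF -gE Cg /=.
  apply/eqP/setP => i; rewrite !inE.
  have := enum_valP i; rewrite -{2}gB => /imsetP[x _ e].
  by apply/imsetP; exists x => //; apply: enum_val_inj; rewrite e gE ffunE.
case=> f; rewrite !inE -CF => /andP[Cf /eqP fT] ->; rewrite Cf /=.
apply/eqP/setP => b; apply/imsetP/idP => [[x _ ->] | bB].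
  by rewrite ffunE enum_valP.
have : enum_rank_in bB b \in f @: [set: A] by rewrite fT inE.
by case/imsetP => x _ e; exists x => //; rewrite ffunE -e enum_rankK_in.
Qed.

Fact card_maps k :
  #|maps k| = (\sum_(m < #|A|.+1) 'C(k, m) * #|onto m|)%N.
Proof.
have im_le (f : {ffun A -> 'I_k}) : (#|f @: [set: A]| < #|A|.+1)%N.
  by rewrite ltnS (leq_trans (leq_imset_card _ _)) // cardsT.
rewrite -sum1_card.
rewrite (partition_big (fun f : {ffun A -> 'I_k} => Ordinal (im_le f)) predT) //=.
apply: eq_bigr => m _.
rewrite (partition_big (fun f : {ffun A -> 'I_k} => f @: [set: A])
          (fun B : {set 'I_k} => #|B| == m)) /=; last first.
  by move=> f /andP[_ /eqP <-].
have := card_draws 'I_k m; rewrite card_ord => <-.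
rewrite -[in RHS]sum1_card big_distrl /=.
apply: eq_big => [B | B /eqP Bm]; first by rewrite inE.
have := card_fiber B; rewrite mul1n Bm => <-.
rewrite -[in RHS]sum1_card; apply: eq_bigl => f; rewrite !inE.
case: (C _) => //=; case: (f @: [set: A] =P B) => [e | _]; rewrite ?andbF ?andbT //.
by apply/eqP/val_inj; rewrite /= e Bm.
Qed.

Fact count_poly (K : fieldType) (charK : [pchar K] =i pred0) :
  {p : {poly K} | forall k, p.[k%:R] = (#|maps k|)%:R}.
Proof.
exists (\sum_(m < #|A|.+1) (#|onto m|)%:R *: hilb K m) => k.
rewrite horner_sum card_maps natr_sum; apply: eq_bigr => m _.
by rewrite hornerZ (hilb_eval charK) natrM mulrC.
Qed.

End OrdinalImage.

Section Ehrhart.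
Variables (K : fieldType) (charK : [pchar K] =i pred0) (A : finType).
Implicit Type P : qposet A.

Fact ehrP_subproof P :
  {p : {poly K} | forall k, (0 < k)%N -> p.[k%:R] = (#|qmaps P k|)%:R}.
Proof.
have [|p pE] := @count_poly A (qhomo P) _ K charK; last by exists p.
move=> f g fg; apply: eq_forallb => x; apply: eq_forallb => y.
by rewrite fg.
Qed.

Fact ehrP_str_subproof P :
  {p : {poly K} | forall k, (0 < k)%N -> p.[k%:R] = (#|qmaps_str P k|)%:R}.
Proof.
have [|p pE] := @count_poly A (qhomo_str P) _ K charK; last by exists p.
move=> f g fg; congr andb; apply: eq_forallb => x; apply: eq_forallb => y.
  by rewrite fg.
by rewrite !eqn_leq !fg.
Qed.

Fact poly_pos_unique (p q : {poly K}) :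
  (forall k, (0 < k)%N -> p.[k%:R] = q.[k%:R]) -> p = q.
Proof.
move=> pq; apply/eqP; rewrite -subr_eq0; apply/negPn/negP => nz.
pose s := [seq k.+1%:R : K | k <- iota 0 (size (p - q))].
have us : uniq s.
  rewrite map_inj_uniq ?iota_uniq // => i j /eqP.
  wlog ij : i j / (i <= j)%N.
    by move=> W; case: (leqP i j) => [|/ltnW] /W // W' e; rewrite W' // eq_sym.
  rewrite eq_sym -subr_eq0 -natrB // (pcharf0P K).1 // subn_eq0 ltnS => ji.
  by apply/eqP; rewrite eqn_leq ij.
have : all (root (p - q)) s.
  by apply/allP => _ /mapP[k _ ->]; rewrite rootE hornerD hornerN pq // subrr.
by move=> /(max_poly_roots nz) /(_ us); rewrite size_map size_iota ltnn.
Qed.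

(* The witnesses are opaque: the polynomials are known only through their values
   at positive integers, which determine them. *)
Definition ehr_of P : {poly K} := sval (ehrP_subproof P).
Definition ehr_str_of P : {poly K} := sval (ehrP_str_subproof P).

Lemma ehr_ofP P k : (0 < k)%N -> (ehr_of P).[k%:R] = (#|qmaps P k|)%:R.
Proof. exact: (svalP (ehrP_subproof P)). Qed.

Lemma ehr_str_ofP P k :
  (0 < k)%N -> (ehr_str_of P).[k%:R] = (#|qmaps_str P k|)%:R.
Proof. exact: (svalP (ehrP_str_subproof P)). Qed.

Lemma ehr_of_unique P (p : {poly K}) :
  (forall k, (0 < k)%N -> p.[k%:R] = (#|qmaps P k|)%:R) -> p = ehr_of P.
Proof. by move=> pP; apply: poly_pos_unique => k k0; rewrite pP // ehr_ofP. Qed.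

Lemma ehr_str_of_unique P (p : {poly K}) :
  (forall k, (0 < k)%N -> p.[k%:R] = (#|qmaps_str P k|)%:R) -> p = ehr_str_of P.
Proof. by move=> pP; apply: poly_pos_unique => k k0; rewrite pP // ehr_str_ofP. Qed.

End Ehrhart.

(* [tag P] is n and ['I_n] stands for {1, ..., n}. *)
Definition QP := {n : nat & qposet 'I_n}.

Definition qiso (P Q : QP) : bool :=
  [exists f : {ffun 'I_(tag P) -> 'I_(tag Q)},
     [&& injectiveb f, [forall y, y \in codom f]
       & [forall x, forall y, qle (tagged Q) (f x) (f y) == qle (tagged P) x y]]].

Lemma qisoP (P Q : QP) :
  reflect (exists2 f : 'I_(tag P) -> 'I_(tag Q), bijective f &
             {mono f : x y / qle (tagged P) x y >-> qle (tagged Q) x y})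
          (qiso P Q).
Proof.
apply: (iffP existsP) => [[f /and3P[/injectiveP finj /forallP fsurj /forallP fle]]|].
  exists f; last by move=> x y; apply/eqP/(forallP (fle x)).
  by exists (fun y => iinv (fsurj y)) => [x|y]; [apply: finj|]; rewrite f_iinv.
case=> f [g fK gK] fle; exists [ffun x => f x]; apply/and3P; split.
- by apply/injectiveP => x y; rewrite !ffunE => /(can_inj fK).
- by apply/forallP => y; apply/codomP; exists (g y); rewrite ffunE gK.
- by apply/forallP => x; apply/forallP => y; rewrite !ffunE fle.
Qed.

Lemma qiso_refl : reflexive qiso.
Proof. by move=> P; apply/qisoP; exists id => //; exists id. Qed.

Lemma qiso_sym : symmetric qiso.
Proof.
suff imp P Q : qiso P Q -> qiso Q P by move=> P Q; apply/idP/idP; apply: imp.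
case/qisoP => f [g fK gK] fle; apply/qisoP; exists g; first by exists f.
by move=> x y; rewrite -fle !gK.
Qed.

Lemma qiso_trans : transitive qiso.
Proof.
move=> Q P R /qisoP[f fb fle] /qisoP[g gb gle]; apply/qisoP.
by exists (g \o f); [exact: bij_comp | move=> x y /=; rewrite gle fle].
Qed.

Canonical qiso_equiv := EquivRel qiso qiso_refl qiso_sym qiso_trans.

Definition qp := {eq_quot qiso_equiv}.
HB.instance Definition _ := Choice.on qp.
HB.instance Definition _ := EqQuotient.on qp.

Section Diagram.
Variables (K : fieldType) (charK : [pchar K] =i pred0).

Definition HQP := {malg K[QP]}.
Definition Hqp := {malg K[qp]}.

Definition isoclass (P : QP) : qp := \pi_qp P.

Definition cls : HQP -> Hqp := linext (fun P : QP => << isoclass P >> : Hqp).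

Definition QPquot (P : QP) (s : {set 'I_(tag P) * 'I_(tag P)}) : QP :=
  Tagged (fun n => qposet 'I_n) (qquot (tagged P) s).

Definition Theta : HQP -> HQP :=
  linext (fun P : QP =>
    \sum_(s : {set 'I_(tag P) * 'I_(tag P)} | qtriangle s (tagged P))
       << QPquot s >> : HQP).

(* The maps on [Hqp] are computed on a representative of each isoclass; the
   choice is immaterial, these values being isomorphism invariants. *)
Definition theta : Hqp -> Hqp :=
  linext (fun c : qp => let P := repr c in
    \sum_(s : {set 'I_(tag P) * 'I_(tag P)} | qtriangle s (tagged P))
       << isoclass (QPquot s) >> : Hqp).

Definition ehr : Hqp -> {poly K} :=
  linext (fun c : qp => ehr_of charK (tagged (repr c))).

Definition ehr_str : Hqp -> {poly K} :=
  linext (fun c : qp => ehr_str_of charK (tagged (repr c))).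

(* The letters of [w] seen as a map on positions, for [w] of length [n]. *)
Definition letter n (w : pword) : 'I_n -> nat := fun i => nth 0%N w i.

Definition EHR : HQP -> WQSym K :=
  linext (fun P : QP =>
    \sum_(w <- pwords (tag P) | qhomo (tagged P) (letter w)) << w >> : WQSym K).

Definition EHR_str : HQP -> WQSym K :=
  linext (fun P : QP =>
    \sum_(w <- pwords (tag P) | qhomo_str (tagged P) (letter w)) << w >> : WQSym K).

End Diagram.

(* Main.v *)
Require Import Defs.
From HB Require Import structures.
From mathcomp Require Import all_boot all_order all_algebra.
From mathcomp Require Import finmap.
From mathcomp.multinomials Require Import monalg.

Set Implicit Arguments.
Unset Strict Implicit.
Unset Printing Implicit Defensive.

Import GRing.Theory.
Local Open Scope ring_scope.

(** Everything rests on two countings.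

    The first concerns quasi-posets. Fix a quasi-poset [P] and a map [f] to the
    integers. If [s ◁ P] and [f] is a strict homomorphism on [P / s], then [f] is
    a homomorphism on [P], and [s] can only be the equivalence whose classes are
    the connected components of the fibres of [f]: strictness forces comparable
    points of a fibre into one class of [s], and connectedness of the classes
    forbids anything larger. Conversely, if [f] is a homomorphism on [P], these
    components do satisfy [s ◁ P], and [f] is strict on the quotient
    ([triangle_fibre_comp]). So the pairs of an [s ◁ P] and a strict homomorphism
    of [P / s] are in bijection with the homomorphisms of [P] ([sum_triangle]).
    With packed words as homomorphisms this is [EHR_str \o Theta = EHR]; with
    maps to [k] points it is [ehr_str \o theta = ehr], by evaluation at [k].

    The second concerns words. A word over [k] letters is given by its packing
    [w] together with its set of letters, so [w] is the packing of
    ['C(k, max w) = H_{max w}(k)] of them. Hence, for a condition [C] on maps that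
    depends only on the relative order of the values, the sum of [H_{max w}] over
    the packed words in [C] is the polynomial that counts the maps in [C]
    ([card_maps_packed], [horner_sum_hilb]). Taking for [C] the (strict)
    homomorphisms of [P] gives [ehr \o cls = H \o EHR] and its strict analogue.
    Taking the condition that a word is the concatenation of a word packing to
    [u] and one packing to [v] gives multiplicativity of [H] ([hilb_mul]).

    Compatibility with the coproducts is the Vandermonde identity
    [H_m(X + Y) = sum_k H_k(X) H_(m-k)(Y)], compatibility with the counits is
    [H_m(0) = 0] for [m > 0], and surjectivity holds since [H_k] has degree [k].
    The remaining square, with [theta] and [Theta], says that [s ◁ P] and [P / s]
    are preserved by isomorphisms. *)

(** * Quotients of a quasi-poset and the fibres of a homomorphism *)

Lemma connect_min (T : finType) (r t : rel T) :
  reflexive t -> transitive t -> subrel r t -> subrel (connect r) t.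
Proof.
move=> t_refl t_trans rt x y /connectP[p rp ->] {y}.
elim: p x rp => [|z p IHp] x //= /andP[/rt xz /IHp]; exact: t_trans.
Qed.

Lemma homo_connect (S T : finType) (r : rel S) (t : rel T) (h : S -> T) :
  {homo h : x y / r x y >-> t x y} ->
  {homo h : x y / connect r x y >-> connect t x y}.
Proof.
move=> rt; apply: (@connect_min _ _ (relpre h (connect t))) => [x|y x z|x y xy].
- exact: connect0.
- exact: connect_trans.
- exact/connect1/rt.
Qed.

Section Fibres.
Variables (A : finType) (P : qposet A).
Implicit Types (f : A -> nat) (s : {set A * A}).

Lemma qquotE s x y :
  qle (qquot P s) x y = connect [rel x y | qle P x y || ((x, y) \in s)] x y.
Proof. by rewrite /qle inE. Qed.

Lemma qrestrE (B : {set A}) u v : qle (qrestr P B) u v = qle P (val u) (val v).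
Proof. by rewrite /qle inE. Qed.

Lemma qle_qquot s x y : qle P x y -> qle (qquot P s) x y.
Proof. by move=> xy; rewrite qquotE connect1 //= xy. Qed.

Lemma mem_qquot s x y : (x, y) \in s -> qle (qquot P s) x y.
Proof. by move=> xy; rewrite qquotE connect1 //= xy orbT. Qed.

Lemma qhomoP f : reflect {homo f : x y / qle P x y >-> (x <= y)%N} (qhomo P f).
Proof.
apply: (iffP forallP) => [h x y xy | h x].
  by have/forallP/(_ y)/implyP := h x; apply.
by apply/forallP => y; apply/implyP; apply: h.
Qed.

Definition fibre_adj f : rel A :=
  [rel x y | (f x == f y) && (qle P x y || qle P y x)].

(** The equivalence whose classes are the connected components of the fibres of
    [f]: two points of a finite topological space lie in one component exactly
    when a chain of comparable points joins them. *)
Definition fibre_comp f : {set A * A} :=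
  [set xy | connect (fibre_adj f) xy.1 xy.2].

Lemma fibre_compE f x y : ((x, y) \in fibre_comp f) = connect (fibre_adj f) x y.
Proof. by rewrite inE. Qed.

Lemma fibre_comp_sym f : connect_sym (fibre_adj f).
Proof. by apply: sym_connect_sym => x y; rewrite /fibre_adj /= eq_sym orbC. Qed.

Lemma fibre_comp_const f x y : connect (fibre_adj f) x y -> f x = f y.
Proof.
move=> xy; apply/eqP; move: xy.
apply: (@connect_min _ _ (relpre f eq_op)) => [{}x|{}y {}x z|{}x {}y] /=.
- exact: eqxx.
- by move=> /eqP ->.
- by case/andP.
Qed.

(** Along a chain in [P / fibre_comp f] the value of [f] grows; if it is the same
    at both ends it never changes, so the whole chain stays in one component. *)
Lemma fibre_comp_qquot f : qhomo P f -> forall x y,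
  qle (qquot P (fibre_comp f)) x y ->
  (f x <= f y)%N /\ (f x = f y -> connect (fibre_adj f) x y).
Proof.
move=> /qhomoP fP x y; rewrite qquotE.
pose t := [rel x y | (f x <= f y)%N && ((f x == f y) ==> connect (fibre_adj f) x y)].
move=> xy; suff /andP[-> /implyP h] : t x y by split=> // /eqP/h.
apply: (@connect_min _ _ t) xy => {x y} [x | y x z | x y] /=.
- by rewrite leqnn eqxx connect0.
- move=> /andP[xy /implyP cxy] /andP[yz /implyP cyz].
  rewrite (leq_trans xy yz); apply/implyP => /eqP xz.
  have eyz : f y == f z by rewrite eqn_leq yz -xz xy.
  by apply: connect_trans (cyz eyz); apply: cxy; rewrite xz -(eqP eyz).
- case/orP => [xy | ]; last first.
    by rewrite fibre_compE => xy; rewrite (fibre_comp_const xy) leqnn xy implybT.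
  by rewrite fP //; apply/implyP => e; rewrite connect1 // /fibre_adj /= e xy.
Qed.

Lemma equivalence_graphP s :
  reflect [/\ forall x, (x, x) \in s,
              forall x y, (x, y) \in s -> (y, x) \in s
            & forall x y z, (x, y) \in s -> (y, z) \in s -> (x, z) \in s]
          (equivalence_graph s).
Proof.
apply: (iffP andP) => [[/andP[/forallP sr /forallP st] /forallP ss] | [sr ss st]].
  split=> // [x y xy | x y z xy yz].
    by have/forallP/(_ y)/implyP := ss x; apply.
  by have/forallP/(_ y)/forallP/(_ z)/implyP/(_ xy)/implyP := st x; apply.
split; [apply/andP; split|]; apply/forallP => // x; apply/forallP => y.
  by apply/forallP => z; apply/implyP => xy; apply/implyP; apply: st xy.
by apply/implyP; apply: ss.
Qed.

Lemma equivalence_fibre_comp f : equivalence_graph (fibre_comp f).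
Proof.
apply/equivalence_graphP; split=> [x | x y | x y z]; rewrite !fibre_compE.
- exact: connect0.
- by rewrite fibre_comp_sym.
- exact: connect_trans.
Qed.

Lemma qopenP (B : finType) (Q : qposet B) (O : {set B}) :
  reflect (forall x y, x \in O -> qle Q x y -> y \in O) (qopen Q O).
Proof.
apply: (iffP forallP) => [h x y xO | h x].
  by have/implyP/(_ xO)/forallP/(_ y)/implyP := h x.
by apply/implyP => xO; apply/forallP => y; apply/implyP; apply: h.
Qed.

(** A clopen set is stable under comparability in both directions, hence contains
    the whole component of each of its points. *)
Lemma connected_fibre_comp f x :
  qconnected (qrestr P [set y | (x, y) \in fibre_comp f]).
Proof.
set B := [set y | _]; set Q := qrestr P B.
have inB y : (y \in B) = connect (fibre_adj f) x y by rewrite inE fibre_compE.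
apply/forallP => O; apply/implyP => /andP[/qopenP up /qopenP dn].
have stable (u v : {y | y \in B}) : fibre_adj f (val u) (val v) ->
    u \in O -> v \in O.
  case/andP => _; rewrite -!(qrestrE (B := B)) => /orP[uv uO | vu].
    exact: up uO uv.
  by apply: contraLR => vO; have := dn v u; rewrite !in_setC => /(_ vO vu).
have step y z (yB : y \in B) : connect (fibre_adj f) y z ->
    Sub y yB \in O -> forall zB : z \in B, Sub z zB \in O.
  case/connectP=> p; elim: p y yB => [|v p IHp] y yB /=.
    by move=> _ -> yO yB'; rewrite (bool_irrelevance yB' yB).
  case/andP=> yv vp zE yO.
  have vB : v \in B by rewrite inB (connect_trans _ (connect1 yv)) // -inB.
  exact: (IHp v vB vp zE (stable (Sub y yB) (Sub v vB) yv yO)).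
have [-> | [[y yB] yO]] := set_0Vmem O; first by rewrite eqxx.
apply/orP; right; apply/eqP/setP => -[z zB]; rewrite in_setT.
have yz : connect (fibre_adj f) y z.
  by apply: (@connect_trans _ _ x); rewrite -?inB // fibre_comp_sym -inB.
by rewrite (step y z yB yz yO).
Qed.

Lemma fibre_comp_triangle f : qhomo P f -> qtriangle (fibre_comp f) P.
Proof.
move=> fP; apply/and3P; split; first exact: equivalence_fibre_comp.
  by apply/forallP => x; apply: connected_fibre_comp.
apply/forallP => x; apply/forallP => y; apply/eqP; apply/andP/idP.
  move=> [/(fibre_comp_qquot fP)[xy cxy] /(fibre_comp_qquot fP)[yx _]].
  by rewrite fibre_compE cxy //; apply/eqP; rewrite eqn_leq xy.
move=> xy; split; apply: mem_qquot => //.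
by rewrite fibre_compE fibre_comp_sym -fibre_compE.
Qed.

Lemma fibre_comp_str f : qhomo P f -> qhomo_str (qquot P (fibre_comp f)) f.
Proof.
move=> fP; apply/andP; split.
  apply/forallP => x; apply/forallP => y; apply/implyP.
  by move=> /(fibre_comp_qquot fP)[].
apply/forallP => x; apply/forallP => y; apply/implyP.
move=> /andP[xy /eqP e]; rewrite /qsim xy /=.
have [_ /(_ e)] := fibre_comp_qquot fP xy.
by rewrite fibre_comp_sym -fibre_compE => /mem_qquot.
Qed.

(** If [f] is strict on [P / s] then it is constant on the classes of [s], and two
    comparable points with equal values are equivalent in [P / s]; so [s] contains
    [fibre_comp f]. Conversely, inside a class of [s] the points joined to a given
    one form a clopen set, so connectedness forces the other inclusion. *)
Lemma triangle_unique s f :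
  qtriangle s P -> qhomo_str (qquot P s) f -> s = fibre_comp f.
Proof.
case/and3P=> /equivalence_graphP[sr ss st] /forallP conn /forallP sim.
case/andP=> fhomo /forallP fstr.
have simE x y : qsim (qquot P s) x y = ((x, y) \in s).
  by have/forallP/(_ y)/eqP := sim x.
have f_le x y : qle (qquot P s) x y -> (f x <= f y)%N.
  by have /forallP/(_ x)/forallP/(_ y)/implyP := fhomo; apply.
have f_const x y : (x, y) \in s -> f x = f y.
  by rewrite -simE => /andP[xy yx]; apply/eqP; rewrite eqn_leq !f_le.
have adj_s x y : fibre_adj f x y -> (x, y) \in s.
  have le_s u v : f u = f v -> qle P u v -> (u, v) \in s.
    move=> e uv; rewrite -simE.
    by have/forallP/(_ v)/implyP := fstr u; apply; rewrite qle_qquot //= e.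
  by case/andP => /eqP e /orP[/le_s | /le_s /ss]; apply.
apply/setP => -[x y]; rewrite fibre_compE; apply/idP/idP => [xy | ]; last first.
  apply: (@connect_min _ _ [rel x y | (x, y) \in s]) => //=.
  by move=> v u w; apply: st.
set B := [set z | (x, z) \in s].
pose O := [set u : {z | z \in B} | connect (fibre_adj f) x (val u)].
have fB (u : {z | z \in B}) : f (val u) = f x.
  by have := valP u; rewrite inE => /f_const.
have adjB (u v : {z | z \in B}) : qle P (val u) (val v) ->
    fibre_adj f (val u) (val v).
  by move=> uv; rewrite /fibre_adj /= !fB eqxx uv.
have xB : x \in B by rewrite inE.
have yB : y \in B by rewrite inE.
have : qopen (qrestr P B) O && qopen (qrestr P B) (~: O).
  apply/andP; split; apply/qopenP => u v; rewrite !inE qrestrE => uO.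
    by move=> /adjB/connect1; apply: connect_trans.
  move=> /adjB/connect1; rewrite fibre_comp_sym => vu; apply: contra uO => xv.
  exact: connect_trans vu.
have /forallP/(_ O)/implyP cB := conn x.
move=> /cB /orP[]/eqP/setP.
  by move=> /(_ (Sub x xB)); rewrite !inE /= connect0.
by move=> /(_ (Sub y yB)); rewrite !inE /=.
Qed.

Lemma triangle_fibre_comp s f :
  (qtriangle s P && qhomo_str (qquot P s) f) = qhomo P f && (s == fibre_comp f).
Proof.
apply/andP/andP => [[tri str] | [fP /eqP ->]]; last first.
  by split; [exact: fibre_comp_triangle | exact: fibre_comp_str].
split; last by apply/eqP/triangle_unique.
case/andP: str => /forallP str _.
apply/qhomoP => x y xy; have/forallP/(_ y)/implyP := str x; apply; exact: qle_qquot.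
Qed.

(** Since each homomorphism of [P] is strict on [P / s] for a single [s ◁ P], the
    double sum reaches it once. *)
Lemma sum_triangle (V : nmodType) (I : Type) (r : seq I) (F : I -> A -> nat)
    (G : I -> V) :
  \sum_(s | qtriangle s P) \sum_(i <- r | qhomo_str (qquot P s) (F i)) G i =
  \sum_(i <- r | qhomo P (F i)) G i.
Proof.
rewrite (exchange_big_dep xpredT) //= [RHS]big_mkcond; apply: eq_bigr => i _.
under eq_bigl do rewrite triangle_fibre_comp.
by case: (qhomo P (F i)); rewrite ?big_pred1_eq // big_pred0.
Qed.

End Fibres.

(** * Invariance under isomorphism *)

(** The continuous image of a connected space is connected: preimages of open
    sets under a monotone map are open. *)
Lemma qconnected_image (A B : finType) (P : qposet A) (Q : qposet B) (h : A -> B) :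
  (forall y, exists x, h x = y) -> {homo h : x y / qle P x y >-> qle Q x y} ->
  qconnected P -> qconnected Q.
Proof.
move=> hsurj hle /forallP conn; apply/forallP => O.
apply/implyP => /andP[/qopenP up /qopenP dn].
have hO : (h @^-1: O == set0) || (h @^-1: O == setT).
  have /implyP := conn (h @^-1: O); apply.
  apply/andP; split; apply/qopenP => x y; rewrite !inE => xO /hle xy.
    exact: up xO xy.
  by have := dn (h x) (h y); rewrite !inE => /(_ xO xy).
have memO y b : (forall x, (x \in h @^-1: O) = b) -> (y \in O) = b.
  by move=> hb; have [x <-] := hsurj y; rewrite -(hb x) inE.
case/orP: hO => /eqP/setP hO; apply/orP; [left | right]; apply/eqP/setP => y.
  by rewrite inE; apply: memO => x; rewrite hO inE.
by rewrite inE; apply: memO => x; rewrite hO inE.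
Qed.

Definition pull (A B : Type) (h : A -> B) (xy : A * A) : B * B := (h xy.1, h xy.2).

(** An isomorphism is given with its inverse, and relations on the target are
    pulled back; an equivalence then only needs one direction, the other one being
    the same statement for the inverse. *)
Section Transport.
Variables (A B : finType) (P : qposet A) (Q : qposet B).
Variables (h : A -> B) (g : B -> A).
Hypotheses (hK : cancel h g) (gK : cancel g h).
Hypothesis h_mono : {mono h : x y / qle P x y >-> qle Q x y}.

Implicit Type s : {set B * B}.

Lemma mem_pull s x y : ((x, y) \in pull h @^-1: s) = ((h x, h y) \in s).
Proof. by rewrite inE. Qed.

Lemma qquot_pull s x y :
  qle (qquot P (pull h @^-1: s)) x y = qle (qquot Q s) (h x) (h y).
Proof.
rewrite !qquotE; apply/idP/idP => [|hxy].
  by apply: homo_connect => {}x {}y /=; rewrite h_mono mem_pull.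
rewrite -[x]hK -[y]hK; apply: homo_connect hxy => {}x {}y /=.
by rewrite -h_mono mem_pull !gK.
Qed.

Lemma qtriangle_pull s : qtriangle s Q -> qtriangle (pull h @^-1: s) P.
Proof.
case/and3P=> /equivalence_graphP[sr ss st] /forallP conn /forallP sim.
apply/and3P; split.
- apply/equivalence_graphP; split=> [x | x y | x y z]; rewrite !mem_pull //.
    exact: ss.
  exact: st.
- apply/forallP => x; move: (conn (h x)).
  set C := [set y | _]; set D := [set y | _].
  have CD (u : {y | y \in C}) : g (val u) \in D.
    by have := valP u; rewrite !inE /pull /= gK.
  have DC (u : {y | y \in D}) : h (val u) \in C.
    by have := valP u; rewrite !inE.
  apply: (@qconnected_image _ _ _ _ (fun u => Sub (g (val u)) (CD u))) => [v | u v].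
    by exists (Sub (h (val v)) (DC v)); apply: val_inj; rewrite /= hK.
  by rewrite !qrestrE /= -h_mono !gK.
- apply/forallP => x; apply/forallP => y.
  have /forallP/(_ (h y))/eqP := sim (h x).
  by rewrite mem_pull /qsim !qquot_pull => ->.
Qed.

Lemma qhomo_pull (f : B -> nat) : qhomo Q f = qhomo P (f \o h).
Proof.
apply/qhomoP/qhomoP => fle x y xy; first by apply: fle; rewrite h_mono.
by rewrite -[x]gK -[y]gK; apply: fle; rewrite -h_mono !gK.
Qed.

Lemma qhomo_str_pull (f : B -> nat) : qhomo_str Q f = qhomo_str P (f \o h).
Proof.
rewrite /qhomo_str qhomo_pull; congr andb.
apply/forallP/forallP => str x; apply/forallP => y.
  by have /forallP/(_ (h y)) := str (h x); rewrite /qsim !h_mono.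
have /forallP/(_ (g y)) := str (g x).
by rewrite /qsim -!h_mono /= !gK.
Qed.

Lemma card_ffun_pull k (C : pred {ffun B -> 'I_k}) (D : pred {ffun A -> 'I_k}) :
  (forall f, C f = D [ffun x => f (h x)]) -> #|[set f | C f]| = #|[set f | D f]|.
Proof.
move=> CD; pose F (f : {ffun B -> 'I_k}) : {ffun A -> 'I_k} := [ffun x => f (h x)].
have Finj : injective F.
  move=> f f' /ffunP e; apply/ffunP => y.
  by have := e (g y); rewrite !ffunE gK.
rewrite -(card_imset _ Finj); congr #|pred_of_set _|; apply/setP => f.
apply/imsetP/idP => [[f' + ->] | fD]; first by rewrite !inE CD.
have fE : f = F [ffun y => f (g y)] by apply/ffunP => x; rewrite !ffunE hK.
by exists [ffun y => f (g y)] => //; rewrite inE CD -/(F _) -fE; rewrite inE in fD.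
Qed.

Lemma card_qmaps_iso k : #|qmaps Q k| = #|qmaps P k|.
Proof.
apply: card_ffun_pull => f; rewrite qhomo_pull; apply: eq_forallb => x.
by apply: eq_forallb => y; rewrite /= !ffunE.
Qed.

Lemma card_qmaps_str_iso k : #|qmaps_str Q k| = #|qmaps_str P k|.
Proof.
apply: card_ffun_pull => f; rewrite qhomo_str_pull; congr andb;
  by apply: eq_forallb => x; apply: eq_forallb => y; rewrite /= !ffunE.
Qed.

End Transport.

Lemma isoclassP (P Q : QP) : reflect (isoclass P = isoclass Q) (qiso P Q).
Proof. exact: (eqmodP qiso_equiv). Qed.

Lemma qiso_repr (P : QP) : qiso P (repr (isoclass P)).
Proof. by apply/isoclassP; rewrite [RHS]reprK. Qed.

Lemma sum_triangle_iso (V : nmodType) (G : qp -> V) (P Q : QP) : qiso P Q ->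
  \sum_(s | qtriangle s (tagged P)) G (isoclass (QPquot (P := P) s)) =
  \sum_(s | qtriangle s (tagged Q)) G (isoclass (QPquot (P := Q) s)).
Proof.
case/qisoP => h [g hK gK] h_mono.
have g_mono : {mono g : x y / qle (tagged Q) x y >-> qle (tagged P) x y}.
  by move=> x y; rewrite -h_mono !gK.
have pullK (s : {set 'I_(tag P) * 'I_(tag P)}) : pull h @^-1: (pull g @^-1: s) = s.
  by apply/setP => -[x y]; rewrite !mem_pull !hK.
have pullK' (s : {set 'I_(tag Q) * 'I_(tag Q)}) : pull g @^-1: (pull h @^-1: s) = s.
  by apply/setP => -[x y]; rewrite !mem_pull !gK.
rewrite (reindex (fun s : {set 'I_(tag Q) * 'I_(tag Q)} => pull h @^-1: s)) /=;
  last first.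
  exists (fun s : {set 'I_(tag P) * 'I_(tag P)} => pull g @^-1: s) => s _.
    exact: pullK'.
  exact: pullK.
apply: eq_big => [s | s _].
  apply/idP/idP => [tri |]; last exact: (qtriangle_pull hK gK h_mono).
  by rewrite -(pullK' s); apply: (qtriangle_pull gK hK g_mono) tri.
congr G; apply/isoclassP/qisoP; exists h; first by exists g.
by move=> x y; rewrite (qquot_pull hK gK h_mono).
Qed.

Section EhrhartInvariance.
Variables (K : fieldType) (charK : [pchar K] =i pred0).

Lemma ehr_of_repr (P : QP) :
  ehr_of charK (tagged (repr (isoclass P))) = ehr_of charK (tagged P).
Proof.
have /qisoP[h [g hK gK] h_mono] := qiso_repr P.
apply: ehr_of_unique => k k0; rewrite ehr_ofP //.
by rewrite (card_qmaps_iso hK gK h_mono).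
Qed.

Lemma ehr_str_of_repr (P : QP) :
  ehr_str_of charK (tagged (repr (isoclass P))) = ehr_str_of charK (tagged P).
Proof.
have /qisoP[h [g hK gK] h_mono] := qiso_repr P.
apply: ehr_str_of_unique => k k0; rewrite ehr_str_ofP //.
by rewrite (card_qmaps_str_iso hK gK h_mono).
Qed.

(** At [k > 0] both sides count the same maps to [k] points, by [sum_triangle]. *)
Lemma sum_ehr_str_of (P : QP) :
  \sum_(s | qtriangle s (tagged P)) ehr_str_of charK (qquot (tagged P) s) =
  ehr_of charK (tagged P).
Proof.
apply: ehr_of_unique => k k0; rewrite horner_sum.
under eq_bigr do rewrite ehr_str_ofP //.
rewrite -natr_sum; congr (_%:R); rewrite -sum1dep_card -(sum_triangle (tagged P)).
by apply: eq_bigr => s _; rewrite sum1dep_card.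
Qed.

End EhrhartInvariance.

(** * Packed words *)

Lemma size_undup_map (T U U' : eqType) (f : T -> U) (g : T -> U') (s : seq T) :
  {in s &, forall x y, (f x == f y) = (g x == g y)} ->
  size (undup (map f s)) = size (undup (map g s)).
Proof.
elim: s => //= x s IHs fg.
have -> : (f x \in map f s) = (g x \in map g s).
  have memE (W : eqType) (k : T -> W) :
      (k x \in map k s) = has (fun y => k x == k y) s.
    by apply/mapP/hasP => -[y ys /eqP e]; exists y => //; apply/eqP.
  by rewrite !memE; apply: eq_in_has => y ys; rewrite fg // inE ?eqxx // ys orbT.
have {}IHs := IHs (sub_in2 (mem_behead (s := x :: s)) fg).
by case: ifP => _; rewrite /= IHs.
Qed.

(** The rank of a letter counts the distinct letters up to it, so it only sees the
    relative order of the letters. *)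
Lemma pack_seq_map (T : eqType) (f g : T -> nat) (s : seq T) :
  {in s &, forall x y, (f x <= f y)%N = (g x <= g y)%N} ->
  pack_seq (map f s) = pack_seq (map g s).
Proof.
move=> fg; rewrite /pack_seq -!map_comp; apply/eq_in_map => x xs /=.
rewrite /rank_in !filter_map.
have -> : [seq y <- s | preim f (fun b => (b <= f x)%N) y] =
          [seq y <- s | preim g (fun b => (b <= g x)%N) y].
  by apply: eq_in_filter => y ys /=; rewrite fg.
apply: size_undup_map => y z; rewrite !mem_filter => /andP[_ ys] /andP[_ zs].
by rewrite !eqn_leq !fg.
Qed.

Lemma Pack_map (T : eqType) (f g : T -> nat) (s : seq T) :
  {in s &, forall x y, (f x <= f y)%N = (g x <= g y)%N} ->
  Pack (map f s) = Pack (map g s).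
Proof. by move=> fg; apply: val_inj; apply: pack_seq_map. Qed.

Lemma mem_pword (w : pword) a : (a \in (w : seq nat)) = (0 < a <= maxl w)%N.
Proof.
have /packedP[k wE] := pw_valP w.
by rewrite wE (maxl_iota wE) mem_iota add1n ltnS.
Qed.

Lemma map_letter n (w : pword) :
  size w = n -> [seq letter w i | i <- enum 'I_n] = w :> seq nat.
Proof.
rewrite (map_comp (nth 0%N w) val) val_enum_ord => <-.
exact: mkseq_nth.
Qed.

Lemma maxl_low (w : pword) k : (k <= maxl w)%N -> maxl (pw_low w k) = k.
Proof.
move=> kw; apply: maxl_iota => a.
rewrite mem_filter mem_pword mem_iota add1n ltnS andbC -andbA.
case: (0 < a)%N => //=.
by case: (leqP a k) => ak; rewrite ?andbF // andbT (leq_trans ak).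
Qed.

(** Subtracting [k] from the letters above [k] already gives a packed word. *)
Lemma maxl_high (w : pword) k : maxl (pw_high w k) = (maxl w - k)%N.
Proof.
pose s := [seq a <- (w : seq nat) | (k < a)%N].
pose t := [seq (a - k)%N | a <- s].
have tE : t =i iota 1 (maxl w - k).
  move=> a; rewrite mem_iota add1n ltnS; apply/mapP/andP => [[b] | [a0 aw]].
    rewrite mem_filter mem_pword => /and3P[kb b0 bw] ->.
    by rewrite subn_gt0 kb leq_sub2r.
  exists (a + k)%N; last by rewrite addnK.
  have kw : (k < maxl w)%N by rewrite -subn_gt0 (leq_trans a0).
  rewrite mem_filter mem_pword -{1}[k]add0n ltn_add2r a0 addn_gt0 a0 /=.
  by rewrite addnC -leq_subRL // ltnW.
have pt : packed t by apply/packedP; exists (maxl w - k)%N.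
have -> : pw_high w k = PWord pt.
  rewrite -[RHS]Pack_id /= /pw_high -/s -[s in LHS]map_id; apply: Pack_map => a b.
  rewrite !mem_filter => /andP[ka _] /andP[kb _].
  by rewrite leq_sub2rE // ltnW.
exact: maxl_iota.
Qed.

Lemma maxl_eq0 (w : pword) : (maxl w == 0%N) = (w == pw_nil).
Proof.
apply/eqP/eqP => [w0 | ->]; last exact: big_nil.
apply: val_inj; apply: size0nil; apply/eqP; rewrite -leqn0 leqNgt.
apply/negP => /(mem_nth 0%N); rewrite mem_pword w0 => /andP[a0].
by rewrite leqNgt a0.
Qed.

(** * Counting words by their packing *)

(** The conditions on a word that can be read off its packing, stated for maps so
    that they apply to homomorphisms as well. *)
Definition order_invariant (A : finType) (C : (A -> nat) -> bool) :=
  forall f g : A -> nat,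
    (forall x y, (f x <= f y)%N = (g x <= g y)%N) -> C f = C g.

(** A surjection onto [{0, ..., m - 1}] is, after adding 1 to its values, a packed
    word with maximum [m]. *)
Lemma card_onto n (C : ('I_n -> nat) -> bool) m : order_invariant C ->
  #|[set f in [set f : {ffun 'I_n -> 'I_m} | C (fun x => f x)]
      | f @: [set: 'I_n] == setT]| =
  size [seq w <- pwords n | C (letter w) && (maxl w == m)].
Proof.
move=> Cinv; set O := [set f in _ | _].
pose word (f : {ffun 'I_n -> 'I_m}) := [seq (f i).+1 | i <- enum 'I_n].
have word_mem (f : {ffun 'I_n -> 'I_m}) : f \in O -> word f =i iota 1 m.
  rewrite !inE => /andP[_ /eqP/setP fT] a; rewrite mem_iota add1n ltnS.
  apply/mapP/andP => [[i _ ->] | [a0 am]]; first by rewrite ltn_ord.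
  have am' : (a.-1 < m)%N by rewrite prednK.
  have : Ordinal am' \in f @: [set: 'I_n] by rewrite fT inE.
  by case/imsetP => i _ e; exists i; rewrite ?mem_enum // -e /= prednK.
have word_packed f : f \in O -> pack_seq (word f) = word f.
  move=> fO; have pf : packed (word f) by apply/packedP; exists m; apply: word_mem.
  exact: (congr1 val (Pack_id (PWord pf))).
have letter_word (f : {ffun 'I_n -> 'I_m}) (i : 'I_n) : nth 0%N (word f) i = (f i).+1.
  by rewrite (nth_map i) ?size_enum_ord // nth_ord_enum.
rewrite cardE -(size_map (fun f => Pack (word f))).
apply/perm_size/uniq_perm; last 1 first.
- move=> w; rewrite mem_filter mem_pwords; apply/mapP/andP => [[f] | []].
    rewrite mem_enum => fO ->; rewrite size_map size_map size_enum_ord eqxx.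
    have -> : maxl (Pack (word f)) = m.
      by apply: maxl_iota; rewrite /= word_packed //; apply: word_mem.
    rewrite eqxx andbT; split=> //; move: (fO); rewrite !inE => /andP[Cf fT].
    rewrite (Cinv _ (fun x => f x)) // => x y.
    by rewrite /letter /= word_packed // !letter_word.
  move=> /andP[Cw /eqP wm] /eqP wn.
  have w_lt (i : 'I_n) : (0 < letter w i <= m)%N.
    by rewrite -wm -mem_pword mem_nth // wn.
  have w_lt' (i : 'I_n) : ((letter w i).-1 < m)%N.
    by have /andP[w0 wm'] := w_lt i; rewrite prednK.
  have wE (i : 'I_n) : (Ordinal (w_lt' i)).+1 = letter w i.
    by rewrite /= prednK //; case/andP: (w_lt i).
  pose f : {ffun 'I_n -> 'I_m} := [ffun i => Ordinal (w_lt' i)].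
  have fw : word f = w.
    by rewrite -[RHS](map_letter wn); apply: eq_map => i; rewrite -wE ffunE.
  exists f; last by rewrite fw Pack_id.
  rewrite mem_enum !inE; apply/andP; split.
    by rewrite (Cinv _ (letter w)) // => x y; rewrite !ffunE -ltnS (wE x) (wE y).
  apply/eqP/setP => j; rewrite inE; apply/imsetP.
  have : j.+1 \in (w : seq nat) by rewrite mem_pword wm ltn_ord.
  by rewrite -{1}fw => /mapP[i _ [/val_inj ->]]; exists i.
- rewrite map_inj_in_uniq ?enum_uniq // => f f'; rewrite !mem_enum => fO fO' e.
  have {}e : word f = word f' by have := congr1 val e; rewrite /= !word_packed.
  apply/ffunP => i; apply: val_inj; apply: succn_inj.
  by rewrite /= -!letter_word e.
- by rewrite filter_uniq // pwords_uniq.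
Qed.

(** A map to [{0, ..., k - 1}] is determined by its image, one of the
    [k]-choose-[m] subsets of size [m], and by its packing, of maximum [m]. *)
Lemma card_maps_packed n (C : ('I_n -> nat) -> bool) k : order_invariant C ->
  #|[set f : {ffun 'I_n -> 'I_k} | C (fun x => f x)]| =
  (\sum_(w <- pwords n | C (letter w)) 'C(k, maxl w))%N.
Proof.
move=> Cinv; rewrite (card_maps Cinv) card_ord.
pose max_ord (w : pword) : 'I_n.+1 := inord (maxl w).
rewrite [RHS]big_seq_cond [RHS](partition_big max_ord predT) //=.
apply: eq_bigr => m _; rewrite (card_onto m Cinv) -sum1_size big_filter big_distrr /=.
rewrite [in LHS]big_seq_cond; apply: eq_big => [w | w].
  case wn: (w \in pwords n) => //=; rewrite mem_pwords in wn.
  by rewrite -val_eqE /= inordK // ltnS -(eqP wn) maxl_le_size.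
by rewrite muln1 => /andP[_ /andP[_ /eqP ->]].
Qed.

Lemma order_invariant_qhomo (A : finType) (P : qposet A) : order_invariant (qhomo P).
Proof.
by move=> f g fg; apply: eq_forallb => x; apply: eq_forallb => y; rewrite fg.
Qed.

Lemma order_invariant_qhomo_str (A : finType) (P : qposet A) :
  order_invariant (qhomo_str P).
Proof.
move=> f g fg; rewrite /qhomo_str (order_invariant_qhomo P fg); congr andb.
by apply: eq_forallb => x; apply: eq_forallb => y; rewrite !eqn_leq !fg.
Qed.

Section HilbertSums.
Variables (K : fieldType) (charK : [pchar K] =i pred0).

Lemma horner_sum_hilb n (C : ('I_n -> nat) -> bool) k : order_invariant C ->
  (\sum_(w <- pwords n | C (letter w)) hilb K (maxl w)).[k%:R] =
  #|[set f : {ffun 'I_n -> 'I_k} | C (fun x => f x)]|%:R.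
Proof.
move=> Cinv; rewrite horner_sum (card_maps_packed k Cinv) natr_sum.
by apply: eq_bigr => w _; rewrite (hilb_eval charK).
Qed.

Lemma ehr_of_hilb n (P : qposet 'I_n) :
  ehr_of charK P = \sum_(w <- pwords n | qhomo P (letter w)) hilb K (maxl w).
Proof.
apply/esym/ehr_of_unique => k _; apply: horner_sum_hilb.
exact: order_invariant_qhomo.
Qed.

Lemma ehr_str_of_hilb n (P : qposet 'I_n) :
  ehr_str_of charK P = \sum_(w <- pwords n | qhomo_str P (letter w)) hilb K (maxl w).
Proof.
apply/esym/ehr_str_of_unique => k _; apply: horner_sum_hilb.
exact: order_invariant_qhomo_str.
Qed.

Definition packs_to n (u : pword) (f : 'I_n -> nat) : bool :=
  Pack [seq f i | i <- enum 'I_n] == u.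

Lemma order_invariant_packs_to n u : order_invariant (@packs_to n u).
Proof.
by move=> f g fg; rewrite /packs_to (@Pack_map _ f g) // => x y _ _; apply: fg.
Qed.

Lemma sum_packs_to n (u : pword) : size u = n ->
  \sum_(w <- pwords n | packs_to u (@letter n w)) hilb K (maxl w) = hilb K (maxl u).
Proof.
move=> un; rewrite big_seq_cond -big_filter.
rewrite (_ : [seq _ <- _ | _] = [:: u]) ?big_seq1 //.
have uP : u \in pwords n by rewrite mem_pwords un.
rewrite -(filter_pred1_uniq (pwords_uniq n) uP); apply: eq_in_filter => w wP.
have /eqP wn : size w == n by rewrite -mem_pwords.
by rewrite wP /= /packs_to map_letter // Pack_id.
Qed.

(** Evaluated at [n], the right side counts the pairs of words over [n] letters
    that pack to [u] and [v], the left side their concatenations. *)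
Lemma hilb_mul (u v : pword) :
  \sum_(w <- pwords (size u + size v)%N |
      (Pack (take (size u) w) == u) && (Pack (drop (size u) w) == v))
    hilb K (maxl w) = hilb K (maxl u) * hilb K (maxl v).
Proof.
set k := size u; set l := size v.
pose C (f : 'I_(k + l) -> nat) :=
  packs_to u (f \o lshift l) && packs_to v (f \o @rshift k l).
have Cinv : order_invariant C.
  move=> f g fg; rewrite /C; congr andb; apply: order_invariant_packs_to => x y /=;
    exact: fg.
transitivity (\sum_(w <- pwords (k + l) | C (letter w)) hilb K (maxl w)).
  rewrite big_seq_cond [RHS]big_seq_cond; apply: eq_bigl => w.
  case wn: (w \in pwords _) => //=; rewrite mem_pwords in wn.
  have sw := eqP wn; rewrite /C /packs_to.
  have -> : [seq (letter w \o lshift l) i | i <- enum 'I_k] = take k w.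
    rewrite (map_comp (nth 0%N w) val) val_enum_ord.
    by rewrite map_nth_iota0 // sw leq_addr.
  have -> // : [seq (letter w \o rshift k (n:=l)) i | i <- enum 'I_l] = drop k w.
  rewrite (map_comp (nth 0%N w \o addn k) val) val_enum_ord map_comp -iotaDl.
  by rewrite addn0 map_nth_iota ?sw ?addKn // take_oversize // size_drop sw addKn.
apply: (poly_pos_unique charK) => n _; rewrite hornerM horner_sum_hilb //.
rewrite -(sum_packs_to (erefl k)) -(sum_packs_to (erefl l)).
rewrite !horner_sum_hilb; try exact: order_invariant_packs_to.
rewrite -natrM -cardsX; congr (_%:R).
pose F (p : {ffun 'I_k -> 'I_n} * {ffun 'I_l -> 'I_n}) :
    {ffun 'I_(k + l) -> 'I_n} :=
  [ffun i => match split i with inl a => p.1 a | inr b => p.2 b end].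
have Fl p a : F p (lshift l a) = p.1 a by rewrite ffunE (unsplitK (inl a)).
have Fr p b : F p (rshift k b) = p.2 b by rewrite ffunE (unsplitK (inr b)).
have Finj : injective F.
  move=> [p q] [p' q'] e; congr pair; apply/ffunP => i.
    by have := Fl (p, q) i; rewrite e Fl.
  by have := Fr (p, q) i; rewrite e Fr.
rewrite -(card_imset _ Finj); congr #|pred_of_set _|; apply/setP => f.
have CF p : C (fun x => F p x) =
    packs_to u (fun x => p.1 x) && packs_to v (fun x => p.2 x).
  rewrite /C; congr andb; apply: order_invariant_packs_to => x y /=.
    by rewrite !Fl.
  by rewrite !Fr.
apply/idP/imsetP => [fC|[p + ->]]; last by rewrite !inE CF.
pose p : {ffun 'I_k -> 'I_n} * {ffun 'I_l -> 'I_n} :=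
  ([ffun a => f (lshift l a)], [ffun b => f (rshift k b)]).
have fE : f = F p.
  apply/ffunP => i; rewrite ffunE -{1}[i]splitK.
  by case: (split i) => j; rewrite /= ffunE.
by exists p => //; move: fC; rewrite {1}fE !inE CF.
Qed.

End HilbertSums.

(** * Linear extensions and evaluations *)

Section LinearExtensions.
Variables (K : fieldType) (B : choiceType).

Lemma eq_linext (V : lmodType K) (f g : B -> V) : f =1 g -> linext f =1 linext g.
Proof. by move=> fg a; apply: eq_bigr => b _; rewrite fg. Qed.

Lemma linext_comp (C : choiceType) (V : lmodType K) (f : B -> {malg K[C]})
    (g : C -> V) a :
  linext g (linext f a) = linext (fun b => linext g (f b)) a.
Proof.
rewrite [linext f a]/linext linear_sum.
by apply: eq_bigr => b _; rewrite linearZ.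
Qed.

Lemma horner_linext (f : B -> {poly K}) a (x : K) :
  (linext f a).[x] = linext (fun b => (f b).[x] : K^o) a.
Proof. by rewrite /linext horner_sum; apply: eq_bigr => b _; rewrite hornerZ. Qed.

End LinearExtensions.

(** * The morphism to polynomials *)

Section Hmap.
Variables (K : fieldType) (charK : [pchar K] =i pred0).

Lemma HmapU (w : pword) : Hmap << w >> = hilb K (maxl w).
Proof. exact: linextU. Qed.

Lemma Hmap_mul (a b : WQSym K) : Hmap (wq_mul a b) = Hmap a * Hmap b.
Proof.
rewrite /Hmap /wq_mul linext_comp [in RHS]/linext mulr_suml; apply: eq_bigr => u _.
rewrite linext_comp -scalerAl; congr (_ *: _).
rewrite mulr_sumr; apply: eq_bigr => v _; rewrite -scalerAr; congr (_ *: _).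
rewrite -(hilb_mul charK) linear_sum.
by apply: eq_bigr => w _; exact: linextU.
Qed.

Lemma natr_inj_pchar0 : injective (fun i => i%:R : K).
Proof.
move=> i j /eqP; wlog ij : i j / (i <= j)%N.
  by move=> W; case: (leqP i j) => [|/ltnW] /W // W' e; rewrite W' // eq_sym.
rewrite eq_sym -subr_eq0 -natrB // (pcharf0P K).1 // subn_eq0 => ji.
by apply/eqP; rewrite eqn_leq ij.
Qed.

(** Fixing the outer variable at an integer leaves polynomials in the inner one
    that agree at all positive integers, hence are equal; so, over the coefficient
    ring [{poly K}], the two polynomials in the outer variable agree at infinitely
    many points. *)
Lemma poly2_pos_unique (p q : {poly {poly K}}) :
  (forall i j, (0 < j)%N -> p.[(i%:R)%:P].[j%:R] = q.[(i%:R)%:P].[j%:R]) -> p = q.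
Proof.
move=> pq; apply/eqP; rewrite -subr_eq0; apply/negPn/negP => nz.
pose s := [seq (i%:R)%:P : {poly K} | i <- iota 0 (size (p - q))].
have us : uniq s by rewrite map_inj_uniq ?iota_uniq // => i j /polyC_inj/natr_inj_pchar0.
have : all (root (p - q)) s.
  apply/allP => _ /mapP[i _ ->]; rewrite rootE hornerD hornerN subr_eq0; apply/eqP.
  by apply: (poly_pos_unique charK) => j j0; apply: pq.
by move=> /(max_poly_roots nz) /(_ us); rewrite size_map size_iota ltnn.
Qed.

Lemma horner_ptens (p q : {poly K}) x y : (ptens p q).[x%:P].[y] = p.[x] * q.[y].
Proof. by rewrite /ptens hornerM hornerC horner_map hornerM hornerC. Qed.

Lemma horner_poly_comul (p : {poly K}) x y : (poly_comul p).[x%:P].[y] = p.[x + y].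
Proof.
rewrite /poly_comul -[fun c => _]/(polyC \o polyC).
elim/poly_ind: p => [|p c IHp]; first by rewrite rmorph0 !horner0.
rewrite rmorphD rmorphM /= map_polyX map_polyC /= !hornerMXaddC.
rewrite !hornerD !hornerM !hornerD IHp !hornerC; congr (_ * _ + _).
by rewrite !horner_ptens !hornerX !hornerC mulr1 mul1r.
Qed.

(** Evaluation at a point of the plane reduces the coproduct identity to one between
    linear forms, where it can be checked on basis words. *)
Lemma horner_tens_map (f : WQSym K -> {poly K}) (t : WQSym2 K) x y :
  (tens_map f t).[x%:P].[y] =
  linext (fun b => (f << b.1 >>).[x] * (f << b.2 >>).[y] : K^o) t.
Proof.
rewrite /tens_map /linext !horner_sum; apply: eq_bigr => b _.
by rewrite hornerZ hornerM hornerC horner_ptens.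
Qed.

(** At a pair of integers this is the Vandermonde convolution of binomial
    coefficients. *)
Lemma Hmap_comul (a : WQSym K) : tens_map (@Hmap K) (wq_comul a) = poly_comul (Hmap a).
Proof.
apply: poly2_pos_unique => i j _.
rewrite horner_tens_map horner_poly_comul /wq_comul linext_comp horner_linext.
apply: (@eq_linext _ _ K^o) => w; rewrite /wq_comulb linear_sum -natrD (hilb_eval charK).
rewrite -binomial.Vandermonde natr_sum big_mkord; apply: eq_bigr => k _.
apply: etrans (linextU _ _) _.
rewrite /= !HmapU maxl_low ?maxl_high -1?ltnS //.
by rewrite !(hilb_eval charK) natrM.
Qed.

Lemma Hmap_counit (a : WQSym K) : poly_counit (Hmap a) = wq_counit a.
Proof.
rewrite /poly_counit horner_linext.
transitivity (linext (fun w : pword => (w == pw_nil)%:R : K^o) a).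
  apply: (@eq_linext _ _ K^o) => w; rewrite -[0]/(0%:R) (hilb_eval charK) bin0n.
  by rewrite maxl_eq0.
rewrite (@linextEw _ _ _ _ _ (pw_nil |` msupp a)%fset) ?fsubsetUr //.
rewrite (big_fsetD1 pw_nil) ?fset1U1 //= big1_fset => [|w].
  by rewrite addr0 [_ *: _]mulr1.
by rewrite !inE => /andP[/negbTE -> _] _; rewrite scaler0.
Qed.

Lemma Hmap_one : Hmap (wq_one K) = 1.
Proof. by rewrite HmapU /maxl big_nil /hilb big_ord0 fact0 invr1 scale1r. Qed.

Lemma Hmap_hopf : hopf_morphism (@Hmap K).
Proof.
split; [exact: linext_linear | | exact: Hmap_comul | exact: Hmap_counit].
by split; [exact: Hmap_one | exact: Hmap_mul].
Qed.

Lemma size_hilb k : size (hilb K k) = k.+1.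
Proof.
rewrite size_scale; last first.
  by rewrite invr_eq0 (pcharf0P K).1 // -lt0n fact_gt0.
by rewrite size_prod_XsubC /index_enum -enumT size_enum_ord.
Qed.

(** The image contains a polynomial of every degree, so leading terms can be
    cancelled one after the other. *)
Lemma Hmap_surj (p : {poly K}) : exists a : WQSym K, Hmap a = p.
Proof.
have [n] := ubnP (size p); elim: n p => // n IHn p; rewrite ltnS => pn.
have [p0|pn'] := leqP (size p) 0.
  by exists 0; rewrite /Hmap linear0; apply/esym/eqP; rewrite -size_poly_leq0.
pose k := (size p).-1; pose q := hilb K k.
have qz : lead_coef q != 0 by rewrite lead_coef_eq0 -size_poly_eq0 size_hilb.
pose c := lead_coef p / lead_coef q.
have pk : packed (iota 1 k) by apply/packedP; exists k.
have sizep : size p = k.+1 by rewrite prednK.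
have [|a aE] := IHn (p - c *: q).
  apply: leq_trans (_ : k < n)%N; last by rewrite -sizep.
  rewrite ltnS; apply/leq_sizeP => j kj; rewrite coefB coefZ.
  have [jk | jk] := eqVneq j k; last first.
    have {}kj : (k < j)%N by rewrite ltn_neqAle eq_sym jk.
    by rewrite !nth_default ?size_hilb ?sizep // mulr0 subrr.
  by rewrite jk -[q`_k](_ : lead_coef q = _) ?divfK ?subrr // /lead_coef size_hilb.
exists (c *: << PWord pk >> + a).
have -> : Hmap (c *: << PWord pk >> + a) = c *: Hmap << PWord pk >> + Hmap a.
  exact: linext_linear.
by rewrite HmapU aE (@maxl_iota _ k) // -/q addrC subrK.
Qed.

End Hmap.

(** * The diagram *)

Section Diagram.
Variables (K : fieldType) (charK : [pchar K] =i pred0).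

Lemma EHR_Theta : @EHR_str K \o @Theta K =1 @EHR K.
Proof.
move=> a /=; rewrite /EHR_str linext_comp; apply: eq_linext => P.
rewrite linear_sum -(sum_triangle (tagged P)); apply: eq_bigr => s _.
exact: linextU.
Qed.

Lemma ehr_theta : ehr_str charK \o @theta K =1 ehr charK.
Proof.
move=> a /=; rewrite /ehr_str linext_comp; apply: eq_linext => c.
rewrite linear_sum -sum_ehr_str_of; apply: eq_bigr => s _.
by apply: etrans (linextU _ _) _; rewrite ehr_str_of_repr.
Qed.

Lemma theta_cls : @theta K \o @cls K =1 @cls K \o @Theta K.
Proof.
move=> a /=; rewrite /theta /cls !linext_comp; apply: eq_linext => P.
apply: etrans (linextU _ _) _; rewrite linear_sum.
rewrite -(sum_triangle_iso (fun c => << c >> : Hqp K) (qiso_repr P)).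
by apply: eq_bigr => s _; symmetry; exact: linextU.
Qed.

Lemma ehr_cls : ehr charK \o @cls K =1 @Hmap K \o @EHR K.
Proof.
move=> a /=; rewrite /ehr /Hmap !linext_comp; apply: eq_linext => P.
apply: etrans (linextU _ _) _; rewrite ehr_of_repr ehr_of_hilb linear_sum.
by apply: eq_bigr => w _; symmetry; exact: linextU.
Qed.

Lemma ehr_str_cls : ehr_str charK \o @cls K =1 @Hmap K \o @EHR_str K.
Proof.
move=> a /=; rewrite /ehr_str /Hmap !linext_comp; apply: eq_linext => P.
apply: etrans (linextU _ _) _; rewrite ehr_str_of_repr ehr_str_of_hilb linear_sum.
by apply: eq_bigr => w _; symmetry; exact: linextU.
Qed.

End Diagram.

Theorem proposition43 (K : fieldType) (charK : [pchar K] =i pred0) :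
  [/\ hopf_morphism (@Hmap K),
      (forall p : {poly K}, exists a : WQSym K, Hmap a = p)
    & [/\ @EHR_str K \o @Theta K =1 @EHR K,
          ehr_str charK \o @theta K =1 ehr charK,
          @theta K \o @cls K =1 @cls K \o @Theta K,
          ehr charK \o @cls K =1 @Hmap K \o @EHR K
        & ehr_str charK \o @cls K =1 @Hmap K \o @EHR_str K]].
Proof.
split; [exact: Hmap_hopf | exact: Hmap_surj |].
by split; [exact: EHR_Theta | exact: ehr_theta | exact: theta_cls
         | exact: ehr_cls | exact: ehr_str_cls].
Qed.
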